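(* Let $n \in \mathbb{N}$. If $f \in C[0,1]$ is a convex function, then for all $x, y \in [0,1]$, $$(B_{2n} f)\left(\frac{x+y}{2}\right) \;\geq\; \sum_{i=0}^{n} \sum_{j=0}^{n} p_{n,i}(x)\, p_{n,j}(y)\, f\left(\frac{i+j}{2n}\right).$$
   Context: $\mathbb{N}$ denotes the positive integers and $C[0,1]$ the set of continuous real-valued functions on $[0,1]$. For $m \in \mathbb{N}$ and $0 \le \nu \le m$, the Bernstein basis polynomials are $p_{m,\nu}(x) = \binom{m}{\nu} x^{\nu} (1-x)^{m-\nu}$ (with $0^0 = 1$). For $f \in C[0,1]$ the $m$-th Bernstein polynomial is $(B_m f)(x) = \sum_{\nu=0}^{m} p_{m,\nu}(x) f\left(\frac{\nu}{m}\right)$ for $x \in [0,1]$; in particular $(B_{2n} f)(x) = \sum_{\nu=0}^{2n} p_{2n,\nu}(x) f\left(\frac{\nu}{2n}\right)$. *)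

(* Defs.v *)
From mathcomp Require Import all_boot all_order all_algebra.
From mathcomp Require Import all_classical all_reals all_analysis.

Set Implicit Arguments.
Unset Strict Implicit.
Unset Printing Implicit Defensive.

Import Order.TTheory GRing.Theory Num.Theory.
Import numFieldNormedType.Exports.

Local Open Scope ring_scope.

Definition bernstein_basis (R : realType) (m k : nat) (x : R) : R :=
  'C(m, k)%:R * x ^+ k * (1 - x) ^+ (m - k).

(* Only the values of [f] on [0, 1] matter when [0 < m]; for [m = 0] the node
   [k / m] is the junk value [0 / 0 = 0]. *)
Definition bernstein (R : realType) (m : nat) (f : R -> R) (x : R) : R :=
  \sum_(k < m.+1) bernstein_basis m k x * f (k%:R / m%:R).

(* Main.v *)
From HB Require Import structures.
Require Import Defs.
From mathcomp Require Import all_boot all_order all_algebra.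
From mathcomp Require Import all_classical all_reals all_analysis.
From mathcomp Require Import ring lra zify.

(** Read [bernstein_basis m k x] as the probability that [k] of [m] independent
    trials of success probability [x] succeed.  The right-hand side is then the
    expectation of [f(S / 2n)], where [S] counts the successes among [n] trials
    of probability [x] and [n] trials of probability [y]; the left-hand side is
    the same expectation once each pair (one [x]-trial, one [y]-trial) is
    replaced by two trials of probability [(x + y) / 2].  This replacement
    keeps the mean and spreads the distribution, so it can only increase the
    expectation of a convex function.

    On generating functions this becomes algebra.  One trial of probability [x]
    has generating polynomial [1 - x + x X], and replacing one pair adds
    [((x - y) / 2)^2 (X - 1)^2] to the generating polynomial of the pair
    ([trial_gf_pair]).  With [U] and [V] the generating polynomials of a pair
    after and before the replacement, the factorization of [U^n - V^n] by
    [U - V] writes the difference of the generating polynomials of the two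
    counts as a nonnegative multiple of [(X - 1)^2 Q], where [Q] has nonnegative
    coefficients and degree at most [2n - 2].  Let [L] be the linear functional
    sending [X^k] to [f(k / 2n)].  It maps [(X - 1)^2 X^k] to
    a second difference of the values of [f] at equally spaced nodes, which is
    nonnegative by convexity; hence [L] is nonnegative on [(X - 1)^2 Q]
    ([pairing_second_difference_ge0]), and this is the inequality. *)

Set Implicit Arguments.
Unset Strict Implicit.
Unset Printing Implicit Defensive.

Import Order.TTheory GRing.Theory Num.Theory.
Import numFieldNormedType.Exports.

Local Open Scope classical_set_scope.
Local Open Scope ring_scope.

(** When [p] is the generating polynomial of a random variable [S] with values
    in [{0, ..., N}], this is the expectation of [g S].  The range stops at a
    fixed [N], not at [size p], to make linearity in [p] immediate. *)
Definition pairing (R : realType) (N : nat) (g : nat -> R) (p : {poly R}) : R :=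
  \sum_(k < N.+1) p`_k * g k.

Lemma pairing_is_linear (R : realType) (N : nat) (g : nat -> R) :
  linear (pairing N g : {poly R} -> R^o).
Proof.
move=> a p q; rewrite /pairing scaler_sumr -big_split.
by apply: eq_bigr => k _; rewrite coefD coefZ mulrDl -mulrA.
Qed.

HB.instance Definition _ (R : realType) (N : nat) (g : nat -> R) :=
  GRing.isLinear.Build R {poly R} R^o _ (pairing N g)
    (pairing_is_linear N g).

Lemma pairingXn (R : realType) (N : nat) (g : nat -> R) (k : nat) :
  (k <= N)%N -> pairing N g 'X^k = g k.
Proof.
rewrite -ltnS => ltkN; rewrite /pairing (bigD1 (Ordinal ltkN)) //= big1 => [|j neqj].
  by rewrite coefXn eqxx mul1r addr0.
by rewrite coefXn (_ : (_ == _) = false) ?mul0r //; apply: negbTE.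
Qed.

(** Multiplying by [(X - 1)^2] is, on coefficients, the adjoint of taking second
    differences: [(X - 1)^2 X^k] is paired with [g] to
    [g (k + 2) - 2 g (k + 1) + g k].  The size bound on [p] keeps [k + 2] within
    the range where [g] is known to be convex. *)
Lemma pairing_second_difference_ge0 (R : realType) (N : nat) (g : nat -> R)
    (p : {poly R}) :
  (forall k, (k.+2 <= N)%N -> 0 <= g k.+2 - 2 * g k.+1 + g k) ->
  p \is a polyOver (@Num.Def.nneg_num_pred R) -> (size p < N)%N ->
  0 <= pairing N g (('X - 1) ^+ 2 * p).
Proof.
move=> g_cvx /polyOverP p_ge0 lt_pN.
rewrite -[p]coefK poly_def mulr_sumr linear_sum sumr_ge0 // => k _.
have lek : (k.+2 <= N)%N by apply: leq_trans lt_pN; rewrite ltnS.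
have -> : ('X - 1) ^+ 2 * (p`_k *: 'X^k) =
    p`_k *: ('X^(k.+2) - 2 *: 'X^(k.+1) + 'X^k).
  by rewrite -scalerAr !exprS -[2 *: _]mul_polyC polyC_natr; congr (_ *: _); ring.
rewrite linearZ linearD linearB linearZ /= !pairingXn //; [|exact: ltnW (ltnW lek)|exact: ltnW].
by rewrite mulr_ge0 ?g_cvx //; apply: p_ge0.
Qed.

(** The probability generating polynomial of one trial with success
    probability [x]. *)
Definition trial_gf (R : realType) (x : R) : {poly R} := (1 - x)%:P + x *: 'X.

Lemma trial_gf_exp (R : realType) (x : R) (m : nat) :
  trial_gf x ^+ m = \sum_(i < m.+1) bernstein_basis m i x *: 'X^i.
Proof.
rewrite /trial_gf exprDn; apply: eq_bigr => i _.
rewrite exprZn -polyC_exp mul_polyC scalerA scalerMnl /bernstein_basis.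
by rewrite -mulr_natl; congr (_ *: _); ring.
Qed.

(** Only the product of the two probabilities changes when both are replaced by
    their mean, so the difference has no term of degree below 2 in [X - 1]:
    [1 - x + x X = 1 + x (X - 1)]. *)
Lemma trial_gf_pair (R : realType) (x y : R) :
  trial_gf ((x + y) / 2) ^+ 2 - trial_gf x * trial_gf y =
  ((x - y) / 2) ^+ 2 *: ('X - 1) ^+ 2.
Proof.
(* Centering at the mean [m] makes the identity polynomial in [m] and [d]. *)
have [m [d [-> ->]]] : exists m d, x = m + d /\ y = m - d.
  by exists ((x + y) / 2), ((x - y) / 2); split; field.
have -> : (m + d + (m - d)) / 2 = m by field.
have -> : (m + d - (m - d)) / 2 = d by field.
by rewrite /trial_gf -!mul_polyC !(polyCD, polyCN, polyC1, polyC_exp); ring.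
Qed.

Lemma trial_gf_nneg (R : realType) (x : R) :
  x \in `[0, 1] -> trial_gf x \is a polyOver (@Num.Def.nneg_num_pred R).
Proof.
rewrite in_itv /= => /andP[x0 x1].
by rewrite rpredD ?polyOverC ?polyOverZ ?polyOverX ?nnegrE ?subr_ge0.
Qed.

Lemma size_trial_gf (R : realType) (x : R) : (size (trial_gf x) <= 2)%N.
Proof.
rewrite /trial_gf (leq_trans (size_polyD _ _)) // geq_max.
rewrite (leq_trans (size_polyC_leq1 _)) //.
by rewrite (leq_trans (size_scale_leq _ _)) ?size_polyX.
Qed.

Lemma bernstein_pairing (R : realType) (m : nat) (f : R -> R) (x : R) :
  bernstein m f x = pairing m (fun k => f (k%:R / m%:R)) (trial_gf x ^+ m).
Proof.
rewrite trial_gf_exp linear_sum; apply: eq_bigr => k _.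
by rewrite linearZ /= pairingXn // -ltnS.
Qed.

(** The generating polynomial of a sum of independent counts is the product of
    theirs, so the double sum is an expectation over the total count. *)
Lemma bernstein_product_pairing (R : realType) (m n : nat) (g : nat -> R)
    (x y : R) :
  \sum_(i < m.+1) \sum_(j < n.+1)
    bernstein_basis m i x * bernstein_basis n j y * g (i + j)%N =
  pairing (m + n) g (trial_gf x ^+ m * trial_gf y ^+ n).
Proof.
rewrite !trial_gf_exp mulr_suml linear_sum; apply: eq_bigr => i _.
rewrite mulr_sumr linear_sum; apply: eq_bigr => j _.
have -> : bernstein_basis m i x *: 'X^i * (bernstein_basis n j y *: 'X^j) =
    (bernstein_basis m i x * bernstein_basis n j y) *: 'X^(i + j).
  by rewrite -scalerAl -[in LHS]scalerAr scalerA exprD.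
rewrite linearZ /= pairingXn //.
by rewrite leq_add // -ltnS.
Qed.

Lemma convex_second_difference_ge0 (R : realType) (f : R -> R) (a h : R) :
  convex_function (`[0, 1] : set R^o) f ->
  a - h \in `[0, 1] -> a + h \in `[0, 1] ->
  0 <= f (a + h) - 2 * f a + f (a - h).
Proof.
move=> f_cvx ah0 ah1.
have half0 : 0 <= 2^-1 :> R by lra.
have half1 : 2^-1 <= 1 :> R by lra.
have := f_cvx (Itv01 half0 half1) (a + h) (a - h).
rewrite !inE => /(_ ah1 ah0); rewrite convRE.
rewrite [X in f X <= _](_ : _ = a); last by rewrite [LHS]convRE /= /unstable.onem; field.
rewrite /= /unstable.onem; lra.
Qed.

Theorem theorem1 (R : realType) (n : nat) (n_gt0 : (0 < n)%N) (f : R -> R)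
    (f_continuous : {within `[0, 1], continuous f})
    (f_convex : convex_function (`[0, 1] : set R^o) f)
    (x y : R) (x01 : x \in `[0, 1]) (y01 : y \in `[0, 1]) :
  bernstein (2 * n) f ((x + y) / 2) >=
    \sum_(i < n.+1) \sum_(j < n.+1)
      bernstein_basis n i x * bernstein_basis n j y *
        f ((i + j)%:R / (2 * n)%:R).
Proof.
pose g k := f (k%:R / (2 * n)%:R).
rewrite (bernstein_product_pairing n n g) addnn -mul2n bernstein_pairing -/g.
(* Group the [2n] trials in pairs, to compare two [n]-th powers. *)
rewrite -subr_ge0 -linearB exprM -exprMn subrXX trial_gf_pair.
rewrite -scalerAl linearZ /= mulr_ge0 ?sqr_ge0 //.
have m01 : (x + y) / 2 \in `[0, 1].
  by move: x01 y01; rewrite !in_itv /= => /andP[? ?] /andP[? ?]; apply/andP; split; lra.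
apply: pairing_second_difference_ge0 => [k lek||].
- have n2_gt0 : 0 < (2 * n)%:R :> R by rewrite ltr0n muln_gt0.
  have node01 j : (j <= 2 * n)%N -> j%:R / (2 * n)%:R \in `[(0 : R), 1].
    by move=> lej; rewrite in_itv /= divr_ge0 //= ler_pdivrMr // mul1r ler_nat.
  have next : k.+2%:R / (2 * n)%:R = k.+1%:R / (2 * n)%:R + (2 * n)%:R^-1 :> R.
    by rewrite -[k.+2]addn1 natrD mulrDl mul1r.
  have prev : k%:R / (2 * n)%:R = k.+1%:R / (2 * n)%:R - (2 * n)%:R^-1 :> R.
    by rewrite -[k.+1]addn1 natrD mulrDl mul1r addrK.
  rewrite /g next prev; apply: convex_second_difference_ge0 => //.
    by rewrite -prev node01 //; lia.
  by rewrite -next node01.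
- by rewrite rpred_sum // => i _; rewrite rpredM ?rpredX ?rpredM ?trial_gf_nneg.
- (* Each term is a product of [n - 1] factors, all of degree at most 2. *)
  rewrite (@leq_ltn_trans (2 * n.-1).+1) //; last lia.
  rewrite (leq_trans (size_sum _ _ _)) //; apply/bigmax_leqP => i _.
  have size2 (u v : R) : ((size (trial_gf u * trial_gf v)%R).-1 <= 2)%N.
    have := size_polyMleq (trial_gf u) (trial_gf v).
    by have := size_trial_gf u; have := size_trial_gf v; lia.
  have sizeX (p : {poly R}) k : ((size p).-1 <= 2)%N ->
      (size (p ^+ k)%R <= (2 * k).+1)%N.
    by move=> sp; rewrite (leq_trans (size_poly_exp_leq _ _)) // ltnS leq_mul2r sp orbT.
  have sizeU := sizeX _ (n.-1 - i)%N (size2 ((x + y) / 2) ((x + y) / 2)).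
  have sizeV := sizeX _ i (size2 x y).
  rewrite (leq_trans (size_polyMleq _ _)) // expr2.
  rewrite (@leq_trans ((2 * (n.-1 - i)).+1 + (2 * i).+1).-1) //.
    by have := leq_sub2r 1 (leq_add sizeU sizeV); rewrite !subn1.
  by case: i {sizeU sizeV} => i /=; lia.
Qed.
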